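(* Let $n\ge1$ be an integer and $\theta$ a real number not algebraic of degree $\le n$, with best approximation polynomials $(P_k)_{k\ge1}$ associated to $\theta,n$. Let \[\underline\sigma=\liminf_{k\to\infty}\frac{\log|P_{k+1}(\theta)|}{\log|P_k(\theta)|},\qquad\overline\tau=\limsup_{k\to\infty}\frac{\log H(P_{k+1})}{\log H(P_k)},\] and let $\ell\ge3$, $d\ge0$ be integers with $(d+1)\ell\le n+d+1$. Assume \[\widehat w_n(\theta)>\frac{[(d+1)\ell-1](w_d(\theta)+1)\,\overline\tau^{\,\ell-1}}{\underline\sigma-1},\] equivalently $\ell<\frac{1}{d+1}\Big(\frac{\widehat w_n(\theta)(\underline\sigma-1)}{\overline\tau^{\,\ell-1}(w_d(\theta)+1)}+1\Big)$. For $j\ge1$ let $\mathscr A_j=\{P_j(T),TP_j(T),\dots,T^dP_j(T)\}$. Then for all sufficiently large $k$ the set $\mathscr B_k=\mathscr A_k\cup\mathscr A_{k+1}\cup\cdots\cup\mathscr A_{k+\ell-1}$, consisting of $(d+1)\ell$ polynomials of degree at most $n+d$, is linearly independent.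
   Context: For a nonzero integer polynomial $P$, $H(P)$ is its height (maximum absolute value of coefficients). For $d\ge1$, $w_d(\theta)$ is the supremum of $w$ such that $|P(\theta)|<H(P)^{-w}$ for infinitely many integer polynomials $P$ of degree at most $d$; by convention $w_0(\theta)=0$. $\widehat w_n(\theta)$ is the supremum of $\widehat w$ such that for every sufficiently large $X$ there is a nonzero integer polynomial $P$ of degree at most $n$ with $H(P)\le X$ and $0<|P(\theta)|<X^{-\widehat w}$. The best approximation polynomials associated to $\theta,n$ are the (assumed unique up to sign) nonzero integer polynomials $P_k$ of degree at most $n$ with $H(P_1)<H(P_2)<\cdots$ such that $|P_k(\theta)|>0$ is minimal among $|P(\theta)|$ over nonzero integer polynomials $P$ of degree $\le n$ with $H(P)<H(P_{k+1})$. *)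

(* Defs.v *)
From HB Require Import structures.
From mathcomp Require Import all_boot all_order all_algebra.
From mathcomp Require Import all_classical all_reals all_analysis.

Set Implicit Arguments.
Unset Strict Implicit.
Unset Printing Implicit Defensive.

Import Order.TTheory GRing.Theory Num.Theory.
Import numFieldNormedType.Exports.

Local Open Scope classical_set_scope.
Local Open Scope ring_scope.

Definition height (P : {poly int}) : nat := (\max_(i < size P) absz (P`_i)%R)%N.

Definition polyR (R : realType) (P : {poly int}) : {poly R} :=
  map_poly (intr : int -> R) P.

Definition evalZ (R : realType) (P : {poly int}) (theta : R) : R :=
  (polyR R P).[theta].

(* By clearing denominators, integer and rational polynomials define the same
   notion. *)
Definition algebraic_of_degree_le (R : realType) (n : nat) (theta : R) : Prop :=
  exists P : {poly int}, [/\ P != 0, (size P <= n.+1)%N & evalZ P theta = 0].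

(* The value may be +oo. At d = 0 the supremum itself would be -1. *)
Definition w_exp (R : realType) (d : nat) (theta : R) : \bar R :=
  if d == 0%N then 0%E else
  ereal_sup (EFin @` [set w : R |
    infinite_set [set P : {poly int} |
      [/\ P != 0, (size P <= d.+1)%N &
          `|evalZ P theta| < (height P)%:R `^ (- w)]]]).

Definition w_hat (R : realType) (n : nat) (theta : R) : \bar R :=
  ereal_sup (EFin @` [set w : R |
    \forall X \near +oo,
      exists P : {poly int},
        [/\ P != 0, (size P <= n.+1)%N, (height P)%:R <= X &
            0 < `|evalZ P theta| < X `^ (- w)]]).

(* The sequence is numbered from 0. Uniqueness up to sign of each minimal
   polynomial need not be required: two minimal polynomials P, Q satisfy
   P(theta) = Q(theta) or P(theta) = - Q(theta), hence Q = P or Q = - P as soon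
   as theta is not algebraic of degree at most n. *)
Definition best_approximations (R : realType) (n : nat) (theta : R)
    (P : nat -> {poly int}) : Prop :=
  forall k,
    [/\ P k != 0, (size (P k) <= n.+1)%N, (height (P k) < height (P k.+1))%N,
        0 < `|evalZ (P k) theta| &
        forall Q : {poly int}, Q != 0 -> (size Q <= n.+1)%N ->
          (height Q < height (P k.+1))%N ->
          `|evalZ (P k) theta| <= `|evalZ Q theta|].

Definition sigma_inf (R : realType) (theta : R) (P : nat -> {poly int}) :
    \bar R :=
  limn_einf (fun k =>
    (ln `|evalZ (P k.+1) theta| / ln `|evalZ (P k) theta|)%:E).

Definition tau_sup (R : realType) (P : nat -> {poly int}) : \bar R :=
  limn_esup (fun k =>
    (ln ((height (P k.+1))%:R : R) / ln ((height (P k))%:R : R))%:E).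

Definition setA_poly (d : nat) (P : {poly int}) : seq {poly int} :=
  [seq 'X^i * P | i <- iota 0 d.+1].

Definition setB_poly (d l : nat) (P : nat -> {poly int}) (k : nat) :
    seq {poly int} :=
  flatten [seq setA_poly d (P j) | j <- iota k l].

(* Linear independence over R in the space of polynomials of degree at most N.
   As npolyp truncates, this is meaningful for polynomials of degree at
   most N only. *)
Definition lin_indep (R : realType) (N : nat) (B : seq {poly int}) : bool :=
  free [seq npolyp N.+1 (polyR R Q) | Q <- B].

(* Main.v *)
(* If the polynomials of B_k are dependent, Cramer's rule yields integer
   polynomials Q_j of degree at most d, not all zero, with
   sum_j Q_j P_(k+j) = 0 and height O(H(P_(k+l-1))^((d+1)l-1)). Let Q_a be the
   first nonzero one. Evaluating at theta and using
   |Q_a(theta)| >> H(Q_a)^(-w_d-eps), the ratio |P_(k+a)(theta)| /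
   |P_(k+a+1)(theta)| is O(H(P_(k+l-1))^(((d+1)l-1)(w_d+1+eps))). On the other
   hand it is at least |P_(k+a)(theta)|^(1-sigma+eps), hence at least
   H(P_(k+a+1))^((what_n-eps)(sigma-1-eps)), whereas
   H(P_(k+l-1)) <= H(P_(k+a+1))^((tau+eps)^(l-1)). By the assumption this is
   impossible for k large. *)

Require Import Defs.
From HB Require Import structures.
From mathcomp Require Import all_boot all_order all_algebra.
From mathcomp Require Import all_classical all_reals all_analysis.
From mathcomp Require Import perm ring lra.

Set Implicit Arguments.
Unset Strict Implicit.
Unset Printing Implicit Defensive.

Import Order.TTheory GRing.Theory Num.Theory.
Import numFieldNormedType.Exports.
Local Open Scope classical_set_scope.
Local Open Scope ring_scope.

(** * Determinant bounds and small integer kernel vectors *)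

(** The Leibniz expansion has r! terms, each a signed product of r entries. *)
Lemma ler_norm_det (R : numDomainType) (r : nat) (M : 'M[R]_r) (h : R) :
  (forall i j, `|M i j| <= h) -> `|\det M| <= r`!%:R * h ^+ r.
Proof.
move=> Mh; apply: le_trans (ler_norm_sum _ _ _) _.
apply: (@le_trans _ _ (\sum_(s : 'S_r) h ^+ r)); last first.
  by rewrite sumr_const -[#|_|]/#|{: 'S_r}| card_Sn mulr_natl.
apply: ler_sum => s _; rewrite normrM normrX normrN1 expr1n mul1r normr_prod.
rewrite -[X in h ^+ X]card_ord -prodr_const.
by apply: ler_prod => i _; rewrite normr_ge0 Mh.
Qed.

(** Each of the r summands is an entry of [u] times a cofactor, that is, a signed determinant of
    size r-1; then r * h * (r-1)! h^(r-1) = r! h^r. *)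
Lemma ler_norm_cramer (R : numDomainType) (r : nat) (M : 'M[R]_r) (u : 'rV[R]_r)
    (h : R) (j : 'I_r) :
  (forall i j, `|M i j| <= h) -> (forall i, `|u 0 i| <= h) ->
  `|(u *m \adj M) 0 j| <= r`!%:R * h ^+ r.
Proof.
case: r M u j => [|r] M u j Mh uh; first by case: j.
have h0 : 0 <= h by exact: le_trans (normr_ge0 _) (uh 0).
rewrite mxE; apply: le_trans (ler_norm_sum _ _ _) _.
apply: (@le_trans _ _ (\sum_(i < r.+1) h * (r`!%:R * h ^+ r))).
  apply: ler_sum => i _; rewrite normrM ler_pM//.
  rewrite mxE /cofactor normrM normrX normrN1 expr1n mul1r.
  by apply: ler_norm_det => a b; rewrite !mxE.
rewrite sumr_const card_ord factS natrM exprS -mulr_natl.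
by rewrite le_eqVlt; apply/orP; left; apply/eqP; ring.
Qed.

(* Cramer's rule: with B a nonvanishing minor of maximal size and i0 a row
   outside it, det B times row i0 is the combination of the rows of B with
   coefficients u * adj B, where u is the part of row i0 in the columns of B. *)
Lemma small_integer_kernel (F : numFieldType) (m N : nat) (A : 'M[int]_(m, N))
    (h : int) :
  1 <= h -> (forall i j, `|A i j| <= h) ->
  ~~ row_free (map_mx (intr : int -> F) A) ->
  exists c : 'rV[int]_m, [/\ c != 0, c *m A = 0 &
    forall j, `|c 0 j| <= m`!%:R * h ^+ m.-1].
Proof.
move=> h1 Ah; set AF := map_mx _ A => nfree.
have inj : injective (intr : int -> F) by exact: intr_inj.
have rm : (\rank AF < m)%N by rewrite ltn_neqAle rank_leq_row andbT.
pose f := maxrankfun AF; pose C := rowsub f AF.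
have Cfull : row_full C^T
  by rewrite /row_full mxrank_tr; exact: maxrowsub_free.
pose g := fullrankfun Cfull.
pose B : 'M[int]_(\rank AF) := mxsub f g A.
have detB : \det B != 0.
  rewrite -(inj_eq inj) rmorph0 -det_map_mx -unitfE -unitmxE -unitmx_tr.
  have -> : (map_mx intr B)^T = rowsub g C^T :> 'M[F]_ _.
    by apply/matrixP => i j; rewrite !mxE.
  exact: fullrowsub_unit.
(* The rank is smaller than m, so the injection [f] misses some row. *)
have [i0 i0f] : exists i0, i0 \notin codom f.
  apply/existsP; rewrite -negb_forall; apply: contraL rm => /forallP cf.
  rewrite -leqNgt -[X in (X <= _)%N]card_ord -[X in (_ <= X)%N]card_ord.
  rewrite -(card_codom (@maxrankfun_inj _ _ _ AF)).
  by apply: subset_leq_card; apply/fintype.subsetP => x _; exact: cf.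
pose u : 'rV[int]_(\rank AF) := \row_a A i0 (g a).
pose w := u *m \adj B.
pose c := \det B *: delta_mx 0 i0 - w *m rowsub f 1%:M.
have cE j : c 0 j = \det B * (j == i0)%:R - \sum_a w 0 a * (f a == j)%:R.
  by rewrite !mxE eqxx; congr (_ - _); apply: eq_bigr => a _; rewrite !mxE.
have ci0 : c 0 i0 = \det B.
  rewrite cE eqxx mulr1 big1 ?subr0// => a _; case: eqP => [fa|_]; last by rewrite mulr0.
  by case/negP: i0f; rewrite -fa; exact: codom_f.
(* The rank is at most m-1 and h >= 1, so bounds for size [\rank AF] may be weakened to the stated
   one. *)
have bnd : (\rank AF)`!%:R * h ^+ \rank AF <= m`!%:R * h ^+ m.-1.
  have h0 : 0 <= h by exact: le_trans h1.
  rewrite ler_pM ?exprn_ge0 ?ler_nat//; first by exact: leq_fact (ltnW rm).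
  by rewrite ler_weXn2l // -ltnS prednK // (leq_trans _ rm).
exists c; split.
- by apply: contra detB => /eqP c0; rewrite -ci0 c0 mxE.
(* Over F, row [i0] is a combination x C of the chosen rows. Restricting to the chosen columns gives
   u = x B, hence u adj B = det B x, and c A = det B (row i0 - x C) = 0. *)
- have [x xE] : exists x, row i0 AF = x *m C.
    by apply/submxP; rewrite eq_maxrowsub row_sub.
  have uE : map_mx intr u = x *m map_mx intr B.
    have -> : map_mx intr B = colsub g C by apply/matrixP => i j; rewrite !mxE.
    have -> : map_mx intr u = colsub g (row i0 AF) by apply/matrixP => i j; rewrite !mxE.
    by rewrite xE -mulmx_colsub.
  suff : map_mx (intr : int -> F) (c *m A) = 0.
    move=> /matrixP cA0; apply/matrixP => i j; apply: inj.
    by have := cA0 i j; rewrite !mxE.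
  rewrite map_mxM/= map_mxB map_mxZ map_mxM/=.
  rewrite map_delta_mx mulmxBl -scalemxAl -rowE -/AF -mulmxA.
  have -> : map_mx intr (rowsub f 1%:M) *m AF = C.
    rewrite /C [RHS]rowsubE; congr (_ *m _).
    by apply/matrixP => i j; rewrite !mxE mulrz_nat.
  rewrite /w map_mxM uE map_mx_adj -(mulmxA x) mul_mx_adj mul_mx_scalar -scalemxAl.
  by rewrite -xE det_map_mx subrr.
(* The entries of [c] are det B at [i0], - w_a at f a, and 0 elsewhere. *)
- move=> j; rewrite cE; have [->|ji0] := eqVneq j i0.
    have := ci0; rewrite cE eqxx => ->.
    by apply: le_trans bnd; apply: ler_norm_det => a b; rewrite mxE.
  rewrite mulr0 sub0r normrN; case: (boolP (j \in codom f)) => [/codomP[a ja]|jf].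
    rewrite (bigD1 a)//= ja eqxx mulr1 big1 ?addr0.
      by apply: le_trans bnd; apply: ler_norm_cramer => *; rewrite mxE.
    by move=> b ba; rewrite (inj_eq (@maxrankfun_inj _ _ _ AF)) (negbTE ba) mulr0.
  rewrite big1 ?normr0; last first.
    move=> a _; case: eqP => [fa|_]; last by rewrite mulr0.
    by case/negP: jf; rewrite -fa; exact: codom_f.
  by apply: le_trans bnd; rewrite mulr_ge0 ?exprn_ge0//; exact: le_trans h1.
Qed.

(** * Heights and values of integer polynomials *)

Lemma absz_coef_height (P : {poly int}) i : (`|(P`_i)%R| <= height P)%N.
Proof.
have [iP|Pi] := ltnP i (size P); last by rewrite nth_default.
by rewrite /height (bigD1 (Ordinal iP))//= leq_maxl.
Qed.

Lemma height_leP (P : {poly int}) h :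
  reflect (forall i, `|(P`_i)%R| <= h)%N (height P <= h)%N.
Proof.
apply: (iffP idP) => [Ph i|Ph]; first exact: leq_trans (absz_coef_height _ _) Ph.
by apply/bigmax_leqP => i _; exact: Ph.
Qed.

Lemma height_gt0 (P : {poly int}) : P != 0 -> (0 < height P)%N.
Proof.
rewrite -lead_coef_eq0 -absz_gt0 => P0.
exact: leq_trans P0 (absz_coef_height _ _).
Qed.

Lemma height_mulXn (P : {poly int}) i : (height ('X^i * P)%R <= height P)%N.
Proof.
by apply/height_leP => j; rewrite coefXnM; case: ifP => // _; exact: absz_coef_height.
Qed.

Section Evaluation.
Variables (R : realType) (theta : R).
Implicit Types P Q : {poly int}.

Lemma evalZ0 : evalZ 0 theta = 0.
Proof. by rewrite /evalZ /polyR rmorph0 horner0. Qed.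

Lemma evalZM P Q : evalZ (P * Q) theta = evalZ P theta * evalZ Q theta.
Proof. by rewrite /evalZ /polyR rmorphM hornerM. Qed.

Lemma evalZ_sum (I : Type) (r : seq I) (p : pred I) (F : I -> {poly int}) :
  evalZ (\sum_(i <- r | p i) F i) theta = \sum_(i <- r | p i) evalZ (F i) theta.
Proof. by rewrite /evalZ /polyR rmorph_sum horner_sum. Qed.

Lemma evalZ_le d P : (size P <= d.+1)%N ->
  `|evalZ P theta| <= (\sum_(i < d.+1) `|theta| ^+ i) * (height P)%:R.
Proof.
move=> Pd; rewrite /evalZ (@horner_coef_wide _ d.+1); last first.
  by rewrite (leq_trans (size_poly _ _)).
rewrite mulr_suml; apply: le_trans (ler_norm_sum _ _ _) _.
apply: ler_sum => i _; rewrite normrM normrX mulrC ler_wpM2l ?exprn_ge0//.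
by rewrite coef_map/= -intr_norm -abszE -pmulrn ler_nat absz_coef_height.
Qed.

Lemma evalZ_linear (q p : int) :
  evalZ (q *: 'X - p%:P) theta = q%:~R * theta - p%:~R.
Proof.
by rewrite /evalZ /polyR rmorphB/= map_polyZ/= map_polyX map_polyC/= !hornerE.
Qed.

End Evaluation.

(** * From linear dependence to a relation with small integer coefficients *)

(** Freeness of [B] over the reals is row freeness of its integer coefficient matrix, so a
    dependence yields a small integer kernel vector. The degree bound ensures that truncation loses
    no coefficient. *)
Lemma not_lin_indep_relation (R : realType) (N H : nat) (B : seq {poly int}) :
  (0 < H)%N -> {in B, forall Q : {poly int}, (size Q <= N.+1)%N && (height Q <= H)%N} ->
  ~~ lin_indep R N B ->
  exists c : nat -> int, [/\ exists2 i, (i < size B)%N & c i != 0,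
    forall i, (`|c i| <= (size B)`! * H ^ (size B).-1)%N &
    \sum_(i < size B) c i *: B`_i = 0].
Proof.
move=> H0 BNH; set m := size B.
pose A : 'M[int]_(m, N.+1) := \matrix_(i, j) B`_i`_j.
have Bi (i : 'I_m) : (size (B`_i)%R <= N.+1)%N && (height (B`_i)%R <= H)%N.
  by apply: BNH; exact: mem_nth.
have [Afree|Anfree] := boolP (row_free (map_mx (intr : int -> R) A)).
  case/negP; rewrite /lin_indep.
  set X := [seq _ | _ <- _].
  have Xm : size X = m by rewrite size_map.
  suff : free (Tuple (introT eqP Xm)) by [].
  apply/freeP => k /= kX i.
  suff /matrixP/(_ 0 i): (\row_i k i : 'rV[R]_m) = 0 by rewrite !mxE.
  apply/eqP; rewrite -(mulmx_free_eq0 _ Afree); apply/eqP/rowP => j.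
  rewrite !mxE; under eq_bigr do rewrite !mxE.
  move/(congr1 (fun q : {poly_N.+1 R} => (q : {poly R})`_j)): kX.
  rewrite [in RHS]/= coef0 => {2}<-.
  rewrite raddf_sum /= coef_sum; apply: eq_bigr => a _.
  rewrite /= coefZ (nth_map 0)//; congr (_ * _).
  by rewrite coef_npolyp ltn_ord coef_map.
move=> _.
have [||c [c0 cA cH]] := @small_integer_kernel R m N.+1 A H%:R _ _ Anfree.
- by rewrite ler1n.
- move=> i j; rewrite mxE -abszE natz lez_nat.
  by have /andP[_] := Bi i; exact/leq_trans/absz_coef_height.
(* The kernel vector is extended by 0 to all indices. *)
pose c' (n : nat) := if insub n is Some i then c 0 i else 0 : int.
have c'E (i : 'I_m) : c' i = c 0 i by rewrite /c' valK.
exists c'; split.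
- have /rV0Pn[i ci] := c0.
  by exists i => //; rewrite c'E.
- move=> i; rewrite /c'; case: insubP => [j _ _|//].
  by rewrite -lez_nat abszE (le_trans (cH j))// -[X in _ <= X]natz natrM natrX.
- apply/polyP => j; rewrite coef0 coef_sum.
  have [jN|Nj] := ltnP j N.+1.
    have /matrixP/(_ 0 (Ordinal jN)) := cA; rewrite !mxE => cAj.
    by rewrite -[RHS]cAj; apply: eq_bigr => i _; rewrite c'E coefZ mxE.
  rewrite big1// => i _; rewrite coefZ nth_default ?mulr0//.
  by have /andP[iN _] := Bi i; exact: leq_trans iN Nj.
Qed.

Lemma size_setA_poly d P : size (setA_poly d P) = d.+1.
Proof. by rewrite size_map size_iota. Qed.

Lemma setB_polyS d l P k :
  setB_poly d l.+1 P k = setA_poly d (P k) ++ setB_poly d l P k.+1.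
Proof. by []. Qed.

Lemma size_setB_poly d l P k : size (setB_poly d l P k) = (d.+1 * l)%N.
Proof.
elim: l k => [|l IH] k; first by rewrite muln0.
by rewrite setB_polyS size_cat size_setA_poly IH mulnS.
Qed.

Lemma nth_setB_poly d l P k a b : (a < l)%N -> (b < d.+1)%N ->
  (setB_poly d l P k)`_(a * d.+1 + b) = 'X^b * P (k + a)%N.
Proof.
elim: l k a => [//|l IH] k [_|a al] bd; rewrite setB_polyS nth_cat size_setA_poly.
  by rewrite mul0n add0n bd addn0 (nth_map 0%N) ?size_iota// nth_iota.
by rewrite mulSn -addnA ltnNge leq_addr/= addKn IH// addSnnS.
Qed.

Lemma mem_setB_poly d l P k Q : Q \in setB_poly d l P k ->
  exists a b, [/\ (a < l)%N, (b < d.+1)%N & Q = 'X^b * P (k + a)%N].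
Proof.
elim: l k => [//|l IH] k; rewrite setB_polyS mem_cat => /orP[/mapP[b]|/IH].
  by rewrite mem_iota => bd ->; exists 0%N, b; rewrite addn0.
by move=> [a [b [al bd ->]]]; exists a.+1, b; rewrite addSnnS.
Qed.

Lemma size_mem_setB_poly n d l (P : nat -> {poly int}) k Q :
  (forall j, (size (P j) <= n.+1)%N) ->
  Q \in setB_poly d l P k -> (size Q <= (n + d).+1)%N.
Proof.
move=> Pn /mem_setB_poly[a [b [_ bd ->]]].
rewrite (leq_trans (size_polyMleq _ _))// size_polyXn /= -addSn addnC.
by rewrite leq_add.
Qed.

(** The integer relation is regrouped by blocks: its coefficient of index a(d+1)+b, attached to T^b
    P_(k+a), becomes the coefficient of T^b in Q_a. Since heights increase, that of P_(k+l-1) bounds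
    them all. *)
Lemma setB_poly_relation (R : realType) n d l (P : nat -> {poly int}) k :
  (0 < l)%N -> (forall j, P j != 0) -> (forall j, (size (P j) <= n.+1)%N) ->
  {homo (fun j => height (P j)) : i j / (i <= j)%N} ->
  ~~ lin_indep R (n + d) (setB_poly d l P k) ->
  exists Q : nat -> {poly int}, [/\ exists2 a, (a < l)%N & Q a != 0,
    forall a, (size (Q a) <= d.+1)%N,
    forall a, (height (Q a) <= (d.+1 * l)`! * height (P (k + l.-1)%N) ^ (d.+1 * l).-1)%N &
    \sum_(a < l) Q a * P (k + a)%N = 0].
Proof.
move=> l0 P0 Pn Ph; set H := height (P (k + l.-1)%N) => ndep.
have [||c] := @not_lin_indep_relation R (n + d) H _ _ _ ndep.
- exact: height_gt0.
- move=> Q QB; rewrite (size_mem_setB_poly Pn QB)/=.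
  have [a [b [al bd ->]]] := mem_setB_poly QB.
  apply: leq_trans (height_mulXn _ _) _; apply: Ph.
  by rewrite leq_add2l -ltnS prednK.
rewrite size_setB_poly => -[[i im ci] cH rel].
exists (fun a => \poly_(b < d.+1) c (a * d.+1 + b)%N); split.
- exists (i %/ d.+1)%N; first by rewrite ltn_divLR// mulnC.
  apply: contra ci => /eqP/polyP/(_ (i %% d.+1)%N).
  by rewrite coef0 coef_poly ltn_mod/= -divn_eq => ->.
- by move=> a; exact: size_poly.
- by move=> a; apply/height_leP => j; rewrite coef_poly; case: ifP.
- rewrite -[RHS]rel -(big_mkord xpredT (fun i => c i *: (setB_poly d l P k)`_i)).
  rewrite [in RHS]mulnC big_nat_mul/= big_mkord; apply: eq_bigr => a _.
  rewrite mulSn -[X in \big[_/_]_(X <= _ < _) _]add0n big_addn addnK big_mkord.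
  rewrite poly_def mulr_suml; apply: eq_bigr => b _.
  by rewrite [(b + _)%N]addnC nth_setB_poly// scalerAl.
Qed.

(** * Extended-real form of the assumption *)

Section EventualBounds.
Context {R : realType}.
Implicit Types (u : (\bar R)^nat) (a : \bar R).

Lemma limn_esup_lt u a :
  (limn_esup u < a)%E -> \forall k \near \oo, (u k < a)%E.
Proof.
move=> /ereal_inf_lt[_ [V VF <-]] supa; near=> k.
apply: le_lt_trans supa; apply: ereal_sup_ubound; exists k => //.
by near: k.
Unshelve. all: by end_near. Qed.

Lemma lt_limn_einf u a :
  (a < limn_einf u)%E -> \forall k \near \oo, (a < u k)%E.
Proof.
rewrite /limn_einf lteNr => /limn_esup_lt; apply: filterS => k.
by rewrite lteN2.
Qed.

Lemma limn_einf_ge u a :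
  (\forall k \near \oo, (a <= u k)%E) -> (a <= limn_einf u)%E.
Proof.
move=> ua; rewrite /limn_einf leeNr; apply: ge_ereal_inf.
exists (ereal_sup [set (- u k)%E | k in [set k | (a <= u k)%E]]).
  by exists [set k | (a <= u k)%E].
by apply: ge_ereal_sup => _ [k /= ak <-]; rewrite leeN2.
Qed.

Lemma limn_esup_ge u a :
  (\forall k \near \oo, (a <= u k)%E) -> (a <= limn_esup u)%E.
Proof. by move=> /limn_einf_ge/le_trans; apply; exact: limn_einf_sup. Qed.

End EventualBounds.

Section Assumptions.
Context {R : realType}.
Variables (D l N : R) (W S T V : \bar R).
Hypotheses (D0 : 0 < D) (N0 : 0 < N) (NE : N = D * l - 1).
Hypotheses (S0 : (0 <= S)%E) (T1 : (1 <= T)%E) (V0 : (0 < V)%E).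

(** The common content of the two assumptions with denominators cleared. The letters stand for D =
    d+1, N = (d+1)l - 1, W = w_hat, S = sigma - 1, T = tau^(l-1) and V = w_d + 1. *)
Let finite_form :=
  [/\ T \is a fin_num, V \is a fin_num & (N%:E * V * T < W * S)%E].

Let TV_cases : (T = +oo%E \/ V = +oo%E) \/
  exists t v : R, [/\ 0 < t, 0 < v, T = t%:E & V = v%:E].
Proof.
move: T1 V0; case: T => [t||]; case: V => [v||]; rewrite ?lee_fin ?lte_fin//.
all: try by (left; left).
all: try by (left; right).
by move=> t1 v0; right; exists t, v; split => //; exact: lt_le_trans t1.
Qed.

Let TV_infinite : T = +oo%E \/ V = +oo%E -> ~ finite_form.
Proof. by move=> TVoo [Tf Vf _]; case: TVoo Tf Vf => ->. Qed.

Lemma first_assumptionP :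
  (S < +oo)%E -> (N%:E * V * T / S < W)%E <-> finite_form.
Proof.
move=> Sy; have T0 : (0 < T)%E by exact: lt_le_trans T1.
have [s [s0 SE]] : exists s, 0 <= s /\ S = s%:E.
  by move: S0 Sy; case: S => [s||]// s0 _; exists s.
case: TV_cases => [TVoo|[t [v [t0 v0 TE VE]]]].
  have -> : (N%:E * V * T)%E = +oo%E.
    by case: TVoo => ->; rewrite ?(gt0_muley, gt0_mulye)// mule_gt0 ?lte_fin.
  have := TV_infinite TVoo; rewrite SE inver; case: eqP => s0'; last first.
    rewrite gt0_mulye ?lte_fin ?invr_gt0 ?lt0r ?s0 ?andbT; last exact/eqP.
    by rewrite ltNge leey.
  by rewrite gt0_mulye// ltNge leey.
(* If S = 0, its inverse is +oo by convention: the first form reads +oo < W and the cleared one N V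
   T < 0, and both fail. *)
rewrite /finite_form SE TE VE -!EFinM inver; case: eqP => [->|/eqP s'0].
  rewrite mule0 gt0_muley ?lte_fin ?mulr_gt0// ltNge leey/=; split=> // -[_ _].
  by rewrite ltNge !mulr_ge0 ?ltW.
have {s'0}s0 : 0 < s by rewrite lt0r s'0.
rewrite -EFinM; case: W => [w||]/=.
- rewrite -EFinM !lte_fin ltr_pdivrMr//; split; [by []|by case].
- by rewrite gt0_mulye ?lte_fin// !ltry.
- by rewrite gt0_mulNye ?lte_fin//; split => // -[].
Qed.

Lemma second_assumptionP :
  (l%:E < (D^-1)%:E * (W * S / (T * V) + 1))%E <-> finite_form.
Proof.
have T0 : (0 < T)%E by exact: lt_le_trans T1.
case: TV_cases => [TVoo|[t [v [t0 v0 TE VE]]]].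
  have -> : (T * V)%E = +oo%E.
    by case: TVoo => ->; rewrite ?(gt0_muley, gt0_mulye).
  (* With an infinite denominator the fraction is 0, and l < 1/D would contradict N > 0. *)
  have := TV_infinite TVoo; rewrite invey mule0 add0e mule1 lte_fin.
  rewrite -[D^-1]mul1r ltr_pdivlMr// mulrC => nf; split => // lD.
  by move: N0; rewrite NE subr_gt0 ltNge ltW.
rewrite /finite_form TE VE -!EFinM inver mulf_eq0 !gt_eqF//=.
have tv0 : 0 < (t * v)^-1 by rewrite invr_gt0 mulr_gt0.
case: (W * S)%E => [x||].
- rewrite -EFinM !lte_fin.
  rewrite [D^-1 * _]mulrC ltr_pdivlMr// -ltrBlDr mulrC -NE ltr_pdivlMr ?mulr_gt0//.
  by rewrite [t * v]mulrC mulrA; split => [|[]].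
- by rewrite gt0_mulye ?lte_fin// addye// gt0_muley ?lte_fin ?invr_gt0// !ltry.
- rewrite gt0_mulNye ?lte_fin// addNye gt0_muleNy ?lte_fin ?invr_gt0//.
  by split => // -[].
Qed.

End Assumptions.

(** * Choice of real exponents with room to spare *)

Lemma lt_mule_approx (R : realType) (A : R) (W S : \bar R) :
  0 < A -> (0 <= S)%E -> (A%:E < W * S)%E ->
  exists w s : R, [/\ 0 < w, 0 < s, (w%:E < W)%E, (s%:E < S)%E & A < w * s].
Proof.
move=> A0 S0 AWS.
(* First come real factors that need not be strictly below [W] and [S]. An infinite factor is
   replaced by A divided by the other one, plus 1. *)
have [w1 [s1 [w10 s10 w1W s1S Aws]]] : exists w s : R,
    [/\ 0 < w, 0 < s, (w%:E <= W)%E, (s%:E <= S)%E & A < w * s].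
  move: S0 AWS; case: S => [s||]//; case: W => [w||]//; rewrite ?lee_fin => s0.
  - rewrite -EFinM lte_fin => Aws; exists w, s; split => //.
    + by rewrite ltNge; apply/negP => w0; have := mulr_le0_ge0 w0 s0; lra.
    + by rewrite lt0r s0 andbT; apply/eqP => s00; move: Aws; rewrite s00 mulr0 ltNge ltW.
  - have [->|s'0 _] := eqVneq s 0; first by rewrite mule0 lte_fin ltNge ltW.
    have {s'0}s0 : 0 < s by rewrite lt0r s'0.
    exists (A / s + 1), s; rewrite leey lexx mulrDl divfK ?gt_eqF//; split => //.
      by rewrite addr_gt0 ?divr_gt0.
    by rewrite mul1r ltrDl.
  - have [->|s'0] := eqVneq s 0; first by rewrite mule0 lte_fin ltNge ltW.
    by rewrite gt0_mulNye// lte_fin lt0r s'0.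
  - move=> Aw; have w0 : 0 < w.
      rewrite ltNge; apply/negP => w0; move: Aw; rewrite ltNge => /negP; apply.
      move: w0; rewrite le_eqVlt => /predU1P[->|w0].
        by rewrite mul0e lee_fin ltW.
      by rewrite lt0_muley ?lte_fin// leNye.
    exists w, (A / w + 1); rewrite leey lexx mulrDr [w * (A / w)]mulrC divfK ?gt_eqF//.
    split => //; first by rewrite addr_gt0 ?divr_gt0.
    by rewrite mulr1 ltrDl.
  - by exists 1, (A + 1); rewrite !leey mul1r ltrDl addr_gt0//.
(* Midpoints then make both bounds strict: w between A/s1 and w1, then s between A/w and s1. *)
have [w [w0 ww1 Aw]] : exists w, [/\ 0 < w, w < w1 & A < w * s1].
  have Aw : A / s1 < w1 by rewrite ltr_pdivrMr.
  exists ((A / s1 + w1) / 2); split; last by rewrite -ltr_pdivrMr// midf_lt.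
    by rewrite divr_gt0// addr_gt0// divr_gt0.
  by rewrite midf_lt.
have As : A / w < s1 by rewrite ltr_pdivrMr// mulrC.
exists w, ((A / w + s1) / 2); split => //.
- by rewrite divr_gt0// addr_gt0// divr_gt0.
- by rewrite (lt_le_trans _ w1W)// lte_fin.
- by rewrite (lt_le_trans _ s1S)// lte_fin midf_lt.
- by rewrite mulrC -ltr_pdivrMr// midf_lt.
Qed.

(** Two midpoints use up the slack: one enlarges v, the other enlarges the power t^(m+1) to some b,
    and t' is the (m+1)-th root of b. *)
Lemma lt_mul_exprn_approx (R : realType) (N v t B : R) (m : nat) :
  0 < N -> 0 < v -> 1 <= t -> N * v * t ^+ m.+1 < B ->
  exists v' t', [/\ v < v', t < t' & N * v' * t' ^+ m.+1 < B].
Proof.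
move=> N0 v0 t1; set p := t ^+ m.+1 => B0.
have t0 : 0 < t by exact: lt_le_trans t1.
have p0 : 0 < p by exact: exprn_gt0.
have vB : v < B / (N * p) by rewrite ltr_pdivlMr ?mulr_gt0// mulrA [v * N]mulrC.
pose v' := (v + B / (N * p)) / 2.
have vv' : v < v' by rewrite midf_lt.
have v'0 : 0 < v' by exact: lt_trans vv'.
have Nv'0 : 0 < N * v' by exact: mulr_gt0.
have pB : p < B / (N * v').
  rewrite ltr_pdivlMr//.
  have -> : p * (N * v') = v' * (N * p) by ring.
  by rewrite -ltr_pdivlMr ?mulr_gt0//; exact: (midf_lt vB).2.
pose b := (p + B / (N * v')) / 2.
have pb : p < b by exact: (midf_lt pB).1.
have b0 : 0 < b by exact: lt_trans pb.
exists v', (b `^ (m.+1%:R^-1)).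
have bE : (b `^ (m.+1%:R^-1)) ^+ m.+1 = b.
  by rewrite -powR_mulrn ?powR_ge0// -powRrM mulVf// powRr1// ltW.
split => //.
- by rewrite -(@ltr_pXn2r _ m.+1)// ?nnegrE ?powR_ge0 ?(ltW t0)// bE.
- by rewrite bE mulrC -ltr_pdivlMr//; exact: (midf_lt pB).2.
Qed.

(** This fixes all the epsilons of the argument at once. It is applied with v = w_d + 1, t = tau, W
    = w_hat and S = sigma - 1. *)
Lemma best_exponents (R : realType) (N v t : R) (W S : \bar R) (m : nat) :
  0 < N -> 0 < v -> 1 <= t -> (0 <= S)%E ->
  (N%:E * v%:E * t%:E ^+ m.+1 < W * S)%E ->
  exists v' t' w s, [/\ v < v', t < t', 0 < w, 0 < s &
    [/\ (w%:E < W)%E, (s%:E < S)%E & N * v' * t' ^+ m.+1 < w * s]].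
Proof.
move=> N0 v0 t1 S0; rewrite -EFin_expe -!EFinM => /lt_mule_approx.
have t0 : 0 < t by exact: lt_le_trans t1.
case=> [||w [s [w0 s0 wW sS /lt_mul_exprn_approx]]]//.
  by rewrite !mulr_gt0// exprn_gt0.
by case=> [|||v' [t' [vv' tt' lt]]]//; exists v', t', w, s.
Qed.

(** * Bounds on best approximations *)

Lemma finite_set_pos_lower_bound (R : realType) (T : choiceType) (A : set T)
    (f : T -> R) :
  finite_set A -> (forall x, A x -> 0 < f x) ->
  exists2 c : R, 0 < c & forall x, A x -> c <= f x.
Proof.
move=> /finite_seqP[s ->]; elim: s => [|y s IH] f0; first by exists 1.
have [|c c0 cf] := IH; first by move=> x xs; apply: f0; rewrite /= inE xs orbT.
exists (Num.min c (f y)).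
  by rewrite lt_min c0 f0//= inE eqxx.
move=> x; rewrite /= inE => /predU1P[->|xs]; first by rewrite ge_min lexx orbT.
by rewrite ge_min cf.
Qed.

Section Approximation.
Context {R : realType}.
Variables (n : nat) (theta : R).
Hypothesis theta_nalg : ~ algebraic_of_degree_le n theta.
Implicit Types Q : {poly int}.

Lemma evalZ_neq0 Q : Q != 0 -> (size Q <= n.+1)%N -> 0 < `|evalZ Q theta|.
Proof.
by move=> Q0 Qn; rewrite normr_gt0; apply/eqP => Qt; apply: theta_nalg; exists Q.
Qed.

(** Above the exponent w_d only finitely many Q have |Q(theta)| < H(Q)^(-v). None of them vanishes
    at theta, so a positive constant accounts for them. *)
Lemma w_exp_lower_bound d (v : R) : (d <= n)%N -> 0 <= v ->
  (w_exp d theta < v%:E)%E ->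
  exists2 c : R, 0 < c & forall Q, Q != 0 -> (size Q <= d.+1)%N ->
    c * (height Q)%:R `^ (- v) <= `|evalZ Q theta|.
Proof.
move=> dn v0 wv; have hge1 Q : Q != 0 -> 1 <= (height Q)%:R :> R.
  by move=> Q0; rewrite ler1n height_gt0.
have hle1 Q : Q != 0 -> (height Q)%:R `^ (- v) <= 1 :> R.
  move=> Q0; rewrite powRN invf_le1 ?powR_gt0 ?(lt_le_trans _ (hge1 _ Q0))//.
  by rewrite -[leLHS](powRr0 (height Q)%:R) ler_powR ?hge1.
move: wv; rewrite /w_exp; case: eqP => [->|_] wv.
  (* For d = 0 the convention w_0 = 0 applies: Q is a nonzero integer, of absolute value at least
     1. *)
  exists 1 => // Q Q0 Q1; rewrite mul1r (le_trans (hle1 _ Q0))//.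
  have /size_poly1P[q q0 ->] : size Q == 1%N.
    by rewrite eqn_leq Q1 lt0n size_poly_eq0.
  by rewrite /evalZ /polyR map_polyC/= hornerC -intr_norm ler1z -gtz0_ge1 normr_gt0.
set A := [set P : {poly int} | [/\ P != 0, (size P <= d.+1)%N &
  `|evalZ P theta| < (height P)%:R `^ (- v)]].
have Afin : finite_set A.
  apply: contrapT => Ainf; move: wv; rewrite ltNge => /negP; apply.
  by apply: ereal_sup_ubound; exists v.
have [|c c0 cA] := finite_set_pos_lower_bound (f := fun Q => `|evalZ Q theta|) Afin.
  by move=> Q [Q0 Qd _]; apply: evalZ_neq0 => //; exact: leq_trans Qd _.
exists (Num.min c 1); first by rewrite lt_min c0 ltr01.
move=> Q Q0 Qd; have [Qv|vQ] := ltP `|evalZ Q theta| ((height Q)%:R `^ (- v)).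
  apply: (@le_trans _ _ c); last exact: cA.
  apply: (@le_trans _ _ (c * 1)); last by rewrite mulr1.
  by rewrite ler_pM ?powR_ge0 ?hle1 ?ge_min ?lexx// le_min ltW// ltW.
apply: le_trans vQ; rewrite -[leRHS]mul1r ler_wpM2r ?powR_ge0//.
by rewrite ge_min lexx orbT.
Qed.

(** For d >= 1 the polynomials qT - floor(q theta), q >= 1, are infinitely many and take values in
    [0, 1) at theta, so the exponent 0 is admissible. *)
Lemma w_exp_ge0 d : (0 <= w_exp d theta)%E.
Proof.
rewrite /w_exp; case: eqP => // /eqP d0; apply: ereal_sup_ubound; exists 0 => //=.
pose L (q : nat) : {poly int} := q.+1%:Z *: 'X - (Num.floor (q.+1%:R * theta))%:P.
have L1 q : (L q)`_1 = q.+1%:Z by rewrite coefB coefZ coefX coefC mulr1 subr0.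
have Linj : injective L.
  by move=> p q /(congr1 (fun Q : {poly int} => Q`_1)); rewrite !L1 => -[].
apply: (@sub_infinite_set _ (range L)); last first.
  move=> /(finite_preimage (in2W Linj)); rewrite preimage_range.
  exact: infinite_nat.
move=> _ [q _ <-]; have L0 : L q != 0.
  by apply: contraNneq (isT : q.+1%:Z != 0) => Lq0; rewrite -L1 Lq0 coef0.
split => //.
  rewrite (leq_trans (size_polyD _ _))// geq_max size_polyN.
  rewrite (leq_trans (size_scale_leq _ _)) ?size_polyX ?ltnS ?lt0n//=.
  by rewrite (leq_trans (size_polyC_leq1 _)).
rewrite oppr0 powRr0 evalZ_linear.
have /andP[fl lf] := floor_itv (q.+1%:R * theta).
by rewrite ger0_norm ?subr_ge0// ltrBlDl -[1]/(1%:~R) -intrD.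
Qed.

(** * Growth of heights and decay of values along the best approximations *)

Variable P : nat -> {poly int}.
Hypothesis bestP : best_approximations n theta P.

Lemma best_neq0 k : P k != 0. Proof. by case: (bestP k). Qed.

Lemma size_best k : (size (P k) <= n.+1)%N. Proof. by case: (bestP k). Qed.

Lemma height_best_lt k : (height (P k) < height (P k.+1))%N.
Proof. by case: (bestP k). Qed.

Lemma best_gt0 k : 0 < `|evalZ (P k) theta|. Proof. by case: (bestP k). Qed.

Lemma best_minimal k Q : Q != 0 -> (size Q <= n.+1)%N ->
  (height Q < height (P k.+1))%N -> `|evalZ (P k) theta| <= `|evalZ Q theta|.
Proof. by case: (bestP k) => _ _ _ _; apply. Qed.

Lemma height_best_nondecreasing :
  {homo (fun j => height (P j)) : i j / (i <= j)%N}.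
Proof.
apply: homo_leq => //; first exact: leq_trans.
by move=> i; exact: ltnW (height_best_lt i).
Qed.

Lemma height_best_ge k : (k < height (P k))%N.
Proof.
elim: k => [|k IH]; first exact: height_gt0 (best_neq0 0).
exact: leq_ltn_trans IH (height_best_lt k).
Qed.

Lemma best_nonincreasing i j :
  (i <= j)%N -> `|evalZ (P j) theta| <= `|evalZ (P i) theta|.
Proof.
move=> /subnKC <-; elim: (j - i)%N => [|m IH]; first by rewrite addn0.
rewrite addnS; apply: le_trans IH; apply: best_minimal; rewrite ?best_neq0 ?size_best//.
by rewrite (ltn_trans (height_best_lt _)) ?height_best_lt.
Qed.

Lemma ln_height_best_cvg (A : R) : \forall k \near \oo, A <= ln (height (P k))%:R.
Proof.
near=> k; rewrite -[A]expRK ler_ln ?posrE ?expR_gt0 ?ltr0n ?height_gt0 ?best_neq0//.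
apply: (@le_trans _ _ k%:R); last by rewrite ler_nat ltnW// height_best_ge.
by near: k; exact: nbhs_infty_ger.
Unshelve. all: by end_near. Qed.

(** The polynomial T - floor(theta) has value in [0, 1) and is a competitor of P_k once H(P_(k+1))
    exceeds its height. *)
Lemma best_lt1 : (0 < n)%N -> \forall k \near \oo, `|evalZ (P k) theta| < 1.
Proof.
move=> n0; pose Q : {poly int} := 1 *: 'X - (Num.floor theta)%:P.
have Q0 : Q != 0.
  by apply/eqP => /polyP/(_ 1%N); rewrite coefB coefZ coefX coefC mulr1 subr0 coef0.
have Qn : (size Q <= n.+1)%N.
  by rewrite /Q scale1r size_XsubC ltnS.
have Q1 : `|evalZ Q theta| < 1.
  rewrite evalZ_linear mul1r.
  have /andP[fl lf] := floor_itv theta.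
  by rewrite ger0_norm ?subr_ge0// ltrBlDl -[1]/(1%:~R) -intrD.
near=> k; apply: le_lt_trans Q1; apply: best_minimal => //.
apply: (@leq_trans k.+1); last by rewrite ltnW// height_best_ge.
by near: k; exact: nbhs_infty_ge.
Unshelve. all: by end_near. Qed.

(** Both logarithms are eventually negative and the values do not increase, so each quotient is at
    least 1. *)
Lemma sigma_inf_ge1 : (0 < n)%N -> (1 <= sigma_inf theta P)%E.
Proof.
move=> n0; apply: limn_einf_ge; have := best_lt1 n0; apply: filterS => k Pk1.
have lnP0 : ln `|evalZ (P k) theta| < 0 by rewrite ln_lt0// best_gt0.
rewrite lee_fin -divrNN ler_pdivlMr ?oppr_gt0// mul1r lerN2.
by rewrite ler_ln ?posrE ?best_gt0// best_nonincreasing.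
Qed.

Lemma tau_sup_ge1 : (1 <= tau_sup R P)%E.
Proof.
apply: limn_esup_ge; have := ln_height_best_cvg 1; apply: filterS => k h1.
rewrite lee_fin ler_pdivlMr ?(lt_le_trans _ h1)// mul1r.
by rewrite ler_ln ?posrE ?ltr0n ?height_gt0 ?best_neq0// ler_nat ltnW ?height_best_lt.
Qed.

(** The definition of w_hat is used at X = H(P_(k+1))/2: halving makes the resulting polynomial
    strictly lower than P_(k+1), hence a competitor of P_k, at the cost of the term ln 2. *)
Lemma lt_w_hat_best (w : R) : 0 < w -> (w%:E < w_hat n theta)%E ->
  \forall k \near \oo,
    w * (ln (height (P k.+1))%:R - ln 2) <= - ln `|evalZ (P k) theta|.
Proof.
move=> w0 /ereal_sup_gt[_ [w' [M [_ MX] <-]]]; rewrite lte_fin => ww'.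
near=> k; set H : R := (height (P k.+1))%:R.
have kH : k.+1%:R <= H by rewrite ler_nat ltnW// height_best_ge.
have [Q [Q0 Qn QH /andP[_ Qw]]] : exists Q : {poly int}, [/\ Q != 0,
    (size Q <= n.+1)%N, (height Q)%:R <= H / 2 &
    0 < `|evalZ Q theta| < (H / 2) `^ (- w')].
  apply: MX; rewrite ltr_pdivlMr//; apply: lt_le_trans kH.
  apply: (@lt_le_trans _ _ k%:R); last by rewrite ler_nat.
  near: k; exact: nbhs_infty_gtr.
have H2 : 1 <= H / 2.
  rewrite ler_pdivlMr// mul1r (le_trans _ kH)// ler_nat ltnS.
  by near: k; exact: nbhs_infty_ge.
have H0 : 0 < H / 2 by exact: lt_le_trans H2.
have PQ : `|evalZ (P k) theta| <= `|evalZ Q theta|.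
  apply: best_minimal => //; rewrite -(ltr_nat R); apply: le_lt_trans QH _.
  by rewrite ltr_pdivrMr// ltr_pMr ?ltr1n// (lt_le_trans _ kH).
rewrite -lnV ?posrE// -lnM ?posrE ?invr_gt0// ?(lt_le_trans _ kH)//.
rewrite lerNr -mulNr; apply: (@le_trans _ _ (- w' * ln (H / 2))).
  by rewrite -ln_powR ler_ln ?posrE ?best_gt0 ?powR_gt0// (le_trans PQ)// ltW.
by rewrite ler_wpM2r ?ln_ge0// lerN2 ltW.
Unshelve. all: by end_near. Qed.

Lemma lt_sigma_inf_best (s : R) : (0 < n)%N -> (s%:E < sigma_inf theta P)%E ->
  \forall k \near \oo,
    s * - ln `|evalZ (P k) theta| <= - ln `|evalZ (P k.+1) theta|.
Proof.
move=> n0 /lt_limn_einf sP; near=> k.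
have lnP0 : ln `|evalZ (P k) theta| < 0.
  by rewrite ln_lt0// best_gt0/=; near: k; exact: best_lt1.
have : (s%:E < (ln `|evalZ (P k.+1) theta| / ln `|evalZ (P k) theta|)%:E)%E.
  by near: k.
by rewrite lte_fin -divrNN ltr_pdivlMr ?oppr_gt0// => /ltW.
Unshelve. all: by end_near. Qed.

Lemma tau_sup_lt_best (t : R) : (tau_sup R P < t%:E)%E ->
  \forall k \near \oo,
    ln (height (P k.+1))%:R <= t * ln (height (P k))%:R.
Proof.
move=> /limn_esup_lt tP; near=> k.
have h1 : 1 <= ln (height (P k))%:R :> R by near: k; exact: ln_height_best_cvg.
have : ((ln ((height (P k.+1))%:R : R) / ln (height (P k))%:R)%:E < t%:E)%E.
  by near: k.
by rewrite lte_fin ltr_pdivrMr ?(lt_le_trans _ h1)// => /ltW.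
Unshelve. all: by end_near. Qed.

(** * Dependence against the growth of the approximations *)

(* The relation with small integer coefficients is evaluated at theta: its
   first nonzero coefficient is bounded below through w_exp, while all later
   terms are at most a multiple of |P_(k + a + 1)(theta)|. *)
Lemma lin_dep_gap (d l : nat) (v : R) :
  (0 < l)%N -> (d <= n)%N -> 0 <= v -> (w_exp d theta < v%:E)%E ->
  exists K : R, forall k, ~~ lin_indep R (n + d) (setB_poly d l P k) ->
    exists2 a, (a.+1 < l)%N &
      ln `|evalZ (P (k + a)%N) theta| - ln `|evalZ (P (k + a).+1) theta| <=
      K + (d.+1 * l).-1%:R * (v + 1) * ln (height (P (k + l.-1)%N))%:R.
Proof.
move=> l0 dn v0 wv; have [c c0 cQ] := w_exp_lower_bound dn v0 wv.
set m := (d.+1 * l)%N; pose C : R := \sum_(i < d.+1) `|theta| ^+ i.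
have C0 : 0 < C.
  rewrite /C big_ord_recl expr0 ltr_wpDr//.
  by apply: sumr_ge0 => i _; rewrite exprn_ge0.
(* [K] gathers the logarithms of all factors independent of k in the inequality [main] below. *)
exists (ln (l%:R * C) - ln c + (v + 1) * ln (m`!)%:R) => k ndep.
have [Q [[a0 a0l Qa0] Qd QH Q0]] :=
  setB_poly_relation l0 best_neq0 size_best height_best_nondecreasing ndep.
have [a Qa amin] : exists2 a, Q a != 0 & forall b, (b < a)%N -> Q b = 0.
  have [|a Qa amin] := @ex_minnP (fun a => Q a != 0); first by exists a0.
  exists a => // b ba; apply/eqP; apply: contraTT ba => /amin.
  by rewrite -leqNgt.
have al : (a < l)%N.
  by apply: leq_ltn_trans a0l; rewrite leqNgt; apply: contra Qa0 => /amin ->.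
set H := height (P (k + l.-1)%N) in QH *.
pose M : nat := (m`! * H ^ m.-1)%N.
have H0 : (0 < H)%N by exact: height_gt0 (best_neq0 _).
have M0 : (0 < M)%N by rewrite muln_gt0 fact_gt0 expn_gt0 H0.
have M0R : 0 < M%:R :> R by rewrite ltr0n.
pose p j : R := `|evalZ (P (k + j)%N) theta|.
have p0 j : 0 < p j by exact: best_gt0.
have Qle b : `|evalZ (Q b) theta| <= C * M%:R.
  by rewrite (le_trans (evalZ_le theta (Qd b)))// ler_pM2l// ler_nat.
(* M bounds the height of Q_a, and a power with exponent -v decreases with its base. *)
have Qge : c * M%:R `^ (- v) <= `|evalZ (Q a) theta|.
  apply: le_trans (cQ _ Qa (Qd a)); rewrite ler_pM2l// !powRN.
  have Qa0' : 0 < (height (Q a))%:R :> R by rewrite ltr0n height_gt0.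
  by rewrite lef_pV2 ?posrE ?powR_gt0// ge0_ler_powR ?nnegrE ?ler_nat ?QH// ltW.
have QP : evalZ (Q a) theta * evalZ (P (k + a)%N) theta =
    - \sum_(b < l | b != Ordinal al) evalZ (Q b) theta * evalZ (P (k + b)%N) theta.
  have := congr1 (fun q => evalZ q theta) Q0.
  rewrite evalZ_sum evalZ0 (bigD1 (Ordinal al))//= evalZM => /eqP.
  rewrite addr_eq0 => /eqP ->; congr (- _); apply: eq_bigr => b _.
  by rewrite evalZM.
(* If a were the last index, all other terms would vanish, and so would Q_a(theta) P_(k+a)(theta);
   but neither factor is zero. *)
have a1l : (a.+1 < l)%N.
  rewrite ltn_neqAle al andbT; apply/eqP => lE.
  have : 0 < `|evalZ (Q a) theta * evalZ (P (k + a)%N) theta|.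
    rewrite normrM mulr_gt0 ?p0//; apply: (evalZ_neq0 Qa).
    by apply: leq_trans (Qd a) _; rewrite ltnS.
  rewrite QP big1 ?oppr0 ?normr0 ?ltxx// => b ba.
  by rewrite amin ?evalZ0 ?mul0r// ltn_neqAle -ltnS lE ltn_ord andbT.
exists a => //.
(* Terms before a vanish; each later one is at most C M |P_(k+a+1)(theta)| because the values do not
   increase. *)
have main : c * M%:R `^ (- v) * p a <= l%:R * C * M%:R * p a.+1.
  apply: (@le_trans _ _ (`|evalZ (Q a) theta| * p a)); first by rewrite ler_pM2r.
  rewrite /p -normrM QP normrN; apply: le_trans (ler_norm_sum _ _ _) _.
  apply: (@le_trans _ _ (\sum_(b < l) C * M%:R * p a.+1)); last first.
    by rewrite sumr_const card_ord -[leLHS]mulr_natl !mulrA lexx.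
  rewrite big_mkcond; apply: ler_sum => b _.
  have CMp0 : 0 <= C * M%:R * p a.+1 by rewrite !mulr_ge0// ltW.
  case: ifP => // ba; have [ltba|gtba|eqab] := ltngtP b a.
  - by rewrite amin// evalZ0 mul0r normr0.
  - by rewrite normrM ler_pM// best_nonincreasing// leq_add2l.
  - by case/eqP: ba; apply: val_inj.
have {main} : ln (c * M%:R `^ (- v) * p a) <= ln (l%:R * C * M%:R * p a.+1).
  by rewrite ler_ln// posrE !mulr_gt0 ?powR_gt0 ?ltr0n.
have -> : ln (c * M%:R `^ (- v) * p a) = ln c - v * ln M%:R + ln (p a).
  by rewrite !lnM ?posrE ?mulr_gt0 ?powR_gt0// ln_powR mulNr.
have -> : ln (l%:R * C * M%:R * p a.+1) = ln (l%:R * C) + ln M%:R + ln (p a.+1).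
  by rewrite lnM ?posrE ?mulr_gt0 ?ltr0n// lnM ?posrE ?mulr_gt0 ?ltr0n.
have -> : ln M%:R = ln (m`!)%:R + m.-1%:R * ln H%:R :> R.
  rewrite natrM natrX lnM ?posrE ?exprn_gt0 ?ltr0n ?fact_gt0//.
  by rewrite lnXn ?ltr0n// mulr_natl.
rewrite /p addnS; lra.
Qed.

(** Put h_j = ln H(P_j) and let A be the factor of h_(k+l-1) in the gap bound. Dependence gives w s
    (h_(k+a+1) - ln 2) <= K + A t^(l-1) h_(k+a+1), which fails for large heights because A t^(l-1) <
    w s. *)
Lemma lin_indep_near (d l : nat) (v t w s : R) :
  (0 < n)%N -> (1 < l)%N -> (d <= n)%N -> 0 <= v -> 1 <= t -> 0 < w -> 0 < s ->
  (w_exp d theta < v%:E)%E -> (tau_sup R P < t%:E)%E ->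
  (w%:E < w_hat n theta)%E -> ((s + 1)%:E < sigma_inf theta P)%E ->
  (d.+1 * l).-1%:R * (v + 1) * t ^+ l.-1 < w * s ->
  \forall k \near \oo, lin_indep R (n + d) (setB_poly d l P k).
Proof.
move=> n0 l1 dn v0 t1 w0 s0 wv taut ww ssigma; set A := _ * (v + 1) => Aws.
have A0 : 0 <= A by rewrite mulr_ge0// addr_ge0.
have [K Kgap] := lin_dep_gap (ltnW l1) dn v0 wv.
pose h j : R := ln (height (P j))%:R.
have h0 j : 0 <= h j by rewrite ln_ge0// ler1n height_gt0 ?best_neq0.
have [k1 _ hw] := lt_w_hat_best w0 ww.
have [k2 _ hs] := lt_sigma_inf_best n0 ssigma.
have [k3 _ ht] := tau_sup_lt_best taut.
(* Beyond this threshold the last inequality fails; the summand 1 makes the contradiction strict. *)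
have [k4 _ hh] := ln_height_best_cvg ((K + w * s * ln 2 + 1) / (w * s - A * t ^+ l.-1)).
near=> k; apply: contrapT => /negP /Kgap[a al]; apply/negP; rewrite -ltNge.
have kka : (k <= k + a)%N by rewrite leq_addr.
have k1a : (k1 <= k + a)%N by apply: leq_trans kka; near: k; exact: nbhs_infty_ge.
have k2a : (k2 <= k + a)%N by apply: leq_trans kka; near: k; exact: nbhs_infty_ge.
have k3k : (k3 <= k)%N by near: k; exact: nbhs_infty_ge.
have k4a : (k4 <= (k + a).+1)%N.
  by apply: leq_trans (leqW kka); near: k; exact: nbhs_infty_ge.
have {hw} := hw _ k1a; have {hs} := hs _ k2a; have {hh} := hh _ k4a.
rewrite ler_pdivrMr ?subr_gt0// -!/(h _).
set p := ln `|evalZ (P (k + a)%N) theta|; set p' := ln `|evalZ _ _|.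
move=> hh hs hw.
(* From k+a+1 to k+l-1 there are l-1-(a+1) steps, each costing a factor t; as t >= 1, the exponent
   may be raised to l-1. *)
have th : h (k + l.-1)%N <= t ^+ l.-1 * h (k + a).+1.
  have tpow e : h ((k + a).+1 + e)%N <= t ^+ e * h (k + a).+1.
    elim: e => [|e IH]; first by rewrite addn0 mul1r.
    rewrite addnS exprS -mulrA (le_trans (ht _ _))//=.
      by rewrite (leq_trans k3k)// -addnS -addnA leq_addr.
    by rewrite ler_pM2l// (lt_le_trans _ t1).
  have -> : (k + l.-1 = (k + a).+1 + (l.-1 - a.+1))%N.
    by rewrite -addnS -addnA subnKC// -ltnS prednK// ltnW.
  by rewrite (le_trans (tpow _))// ler_wpM2r// ler_weXn2l// leq_subr.
(* With q = -ln |P_(k+a)(theta)|, the bound (s+1) q <= -ln |P_(k+a+1)(theta)| leaves a gap of at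
   least s q. *)
have hs' : s * (w * (h (k + a).+1 - ln 2)) <= p - p'.
  have : s * (w * (h (k + a).+1 - ln 2)) <= s * - p by rewrite ler_pM2l.
  lra.
have Ah : A * h (k + l.-1)%N <= A * (t ^+ l.-1 * h (k + a).+1) by rewrite ler_wpM2l.
rewrite -/A; move: hh hs' Ah; clear.
move: (h _) (h _) (t ^+ _) A (ln 2) p p' => X Y T B L q q'; lra.
Unshelve. all: by end_near. Qed.

End Approximation.

(* The quantities are extended reals. In the first form of the assumption the
   fraction is the indeterminate +oo / +oo when sigma = +oo, hence the guard;
   the second form is false whenever tau, or w_d, is +oo. *)
Theorem theorem4p16 (R : realType) (n : nat) (theta : R)
    (P : nat -> {poly int}) (l d : nat) :
  (1 <= n)%N ->
  ~ algebraic_of_degree_le n theta ->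
  best_approximations n theta P ->
  (3 <= l)%N ->
  (d.+1 * l <= n + d.+1)%N ->
  let sigma := sigma_inf theta P in
  let tau := tau_sup R P in
  let wd := w_exp d theta in
  let wn := w_hat n theta in
  let assumption1 :=
    (((d.+1 * l)%:R - 1)%:E * (wd + 1) * tau ^+ l.-1 / (sigma - 1) < wn)%E in
  let assumption2 :=
    (l%:R%:E <
      (d.+1%:R^-1)%:E * (wn * (sigma - 1) / (tau ^+ l.-1 * (wd + 1)) + 1))%E in
  ((sigma < +oo)%E -> (assumption1 <-> assumption2)) /\
  (assumption2 ->
    \forall k \near \oo,
      [/\ size (setB_poly d l P k) = (d.+1 * l)%N,
          all (fun Q : {poly int} => (size Q <= (n + d).+1)%N)
              (setB_poly d l P k) &
          lin_indep R (n + d) (setB_poly d l P k)]).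
Proof.
move=> n0 nalg best l3 dl sigma tau wd wn assumption1 assumption2.
have sigma1 : (1 <= sigma)%E by exact: sigma_inf_ge1 best n0.
have tau1 : (1 <= tau)%E by exact: tau_sup_ge1 best.
have wd0 : (0 <= wd)%E by exact: w_exp_ge0.
have D0 : 0 < d.+1%:R :> R by [].
have m1 : (1 < d.+1 * l)%N by rewrite (leq_trans (ltnW l3))// leq_pmull.
pose N : R := (d.+1 * l)%:R - 1.
have N0 : 0 < N by rewrite subr_gt0 ltr1n.
have NE : N = d.+1%:R * l%:R - 1 by rewrite -natrM.
have S0 : (0 <= sigma - 1)%E by rewrite sube_ge0.
have T1 : (1 <= tau ^+ l.-1)%E.
  elim: l.-1 => // e IH; rewrite expeS.
  by rewrite (le_trans IH)// lee_pemull// (le_trans _ IH).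
have V0 : (0 < wd + 1)%E by rewrite (lt_le_trans lte01)// leeDr.
split.
  move=> sigmaoo; have Soo : (sigma - 1 < +oo)%E by rewrite lte_add_pinfty // -EFinN ltry.
  have A1 := first_assumptionP wn N0 S0 T1 V0 Soo.
  have A2 := second_assumptionP wn (sigma - 1)%E D0 N0 NE T1 V0.
  exact (iff_trans A1 (iff_sym A2)).
move=> /(second_assumptionP wn (sigma - 1)%E D0 N0 NE T1 V0)[Tfin Vfin lt].
(* As l-1 > 0, an infinite tau would make tau^(l-1) infinite. *)
have taufin : tau \is a fin_num.
  move: tau1 Tfin; case: (tau) => [t||]// _.
  suff -> : (+oo ^+ l.-1 = +oo :> \bar R)%E by [].
  have : (0 < l.-1)%N by rewrite -ltnS prednK// ltnW// ltnW.
  elim: l.-1 => // -[|e] IH _; first by [].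
  by rewrite expeS IH.
have wdfin : wd \is a fin_num.
  by move: wd0 Vfin; case: (wd).
pose t := fine tau; pose v := fine wd + 1.
have tE : tau = t%:E by rewrite fineK.
have vE : (wd + 1)%E = v%:E by rewrite EFinD fineK.
have t1 : 1 <= t by rewrite -lee_fin -tE.
have v1 : 1 <= v by rewrite lerDr -lee_fin fineK.
have l1E : l.-1 = l.-2.+1 by case: (l) l3 => [|[|]].
move: lt; rewrite tE vE l1E.
case/best_exponents => //; first exact: lt_le_trans v1.
move=> v' [t' [w [s [vv' tt' w0 s0 [ww ss]]]]]; rewrite -l1E => lt.
(* From 2(d+1) <= (d+1)l <= n+d+1 one gets d < n, so polynomials of degree at most d do not vanish
   at theta unless zero. *)
have dn : (d <= n)%N.
  have : (d.+1 * 2 <= n + d.+1)%N by rewrite (leq_trans _ dl)// leq_pmul2l// ltnW.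
  by rewrite muln2 -addnn leq_add2r => /ltnW.
near=> k; split.
- exact: size_setB_poly.
- by apply/allP => Q; apply: size_mem_setB_poly; exact: size_best best.
(* Since [v'] exceeds w_d + 1, the exponent above w_d is v' - 1. *)
- near: k; apply: (@lin_indep_near _ _ _ nalg _ best d l (v' - 1) t' w s) => //.
  + by rewrite (leq_trans _ l3).
  + by rewrite subr_ge0 (le_trans v1)// ltW.
  + by rewrite (le_trans t1)// ltW.
  + by rewrite EFinB lteBrDr// vE lte_fin.
  + by rewrite -/tau tE lte_fin.
  + by rewrite EFinD -lteBrDr.
  + by rewrite subrK -subn1 natrB// ltnW.
Unshelve. all: by end_near. Qed.
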